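(* Let $R=R_1\times\cdots\times R_s$ be a finite commutative ring with $1\neq0$, where each $R_i$ is a finite local ring with maximal ideal $M_i$ of order $m_i$, $|R_1|/m_1\le\cdots\le|R_s|/m_s$, and $|R_i|/m_i\equiv1\pmod4$ for all $i$. Let $R_0$ be a finite local ring with maximal ideal $M_0$ of order $m_0$ with $|R_0|/m_0\equiv3\pmod4$. Then for every integer $k\ge1$: (a) $s_k(\mathcal{G}_R)=\prod_{i=1}^s\frac{m_i^k(|R_i|/m_i-1)}{2^{k+1}}\times\prod_{i=1}^s\left(2(|R_i|/m_i-1)^{k-1}+\left(-1+\sqrt{|R_i|/m_i}\right)^k+\left(-1-\sqrt{|R_i|/m_i}\right)^k\right)$; (b) $s_k(\mathcal{G}_{R_0\times R})=m_0^k(|R_0|/m_0-1)\left((|R_0|/m_0-1)^{k-1}+(-1)^k\right)\prod_{i=1}^s\frac{m_i^k(|R_i|/m_i-1)}{2^{k+1}}\times\prod_{i=1}^s\left(2(|R_i|/m_i-1)^{k-1}+\left(-1+\sqrt{|R_i|/m_i}\right)^k+\left(-1-\sqrt{|R_i|/m_i}\right)^k\right)$.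
   Context: A local ring is a commutative ring with a unique maximal ideal. For a finite commutative ring $S$, $S^\times$ is its unit group, $Q_S=\{u^2:u\in S^\times\}$, $T_S=Q_S\cup(-Q_S)$, and the quadratic unitary Cayley graph $\mathcal{G}_S$ has vertex set $S$ with $x,y$ adjacent iff $x-y\in T_S$. For a graph $G$ with adjacency eigenvalues $\lambda_1,\dots,\lambda_n$ (with multiplicity), $s_k(G)=\sum_i\lambda_i^k$. *)

(* Defs.v *)
From HB Require Import structures.
From mathcomp Require Import all_boot all_order all_fingroup all_algebra.

Set Implicit Arguments.
Unset Strict Implicit.
Unset Printing Implicit Defensive.

Import GRing.Theory Num.Theory.
Local Open Scope ring_scope.

(* The library's idealr_closed includes properness (1 is not a member). *)
Definition maximal_ideal (S : finComUnitRingType) (M : {set S}) : Prop :=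
  idealr_closed M /\
  forall N : {set S}, idealr_closed N -> M \subset N -> N = M.

(* S is a local ring and M is its unique maximal ideal. *)
Definition local_ring (S : finComUnitRingType) (M : {set S}) : Prop :=
  maximal_ideal M /\ forall N : {set S}, maximal_ideal N -> N = M.

(* |S|/|M|; for an ideal M the division is exact, by Lagrange's theorem. *)
Definition residue_card (S : finComUnitRingType) (M : {set S}) : nat :=
  #|S| %/ #|M|.

(* R_0 x ... x R_n, with n.+1 factors: the empty product is the zero ring,
   excluded by 1 <> 0. The library has no ring structure on {dffun _}. *)
Definition prod_ring (n : nat) (R : 'I_n.+1 -> finComUnitRingType) : Type :=
  {dffun forall i : 'I_n.+1, R i}.

Section ProdRing.
Variables (n : nat) (R : 'I_n.+1 -> finComUnitRingType).
Local Notation P := (prod_ring R).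

HB.instance Definition _ := Finite.copy P {dffun forall i : 'I_n.+1, R i}.

Definition prod_zero : P := [ffun i => 0 : R i].
Definition prod_one : P := [ffun i => 1 : R i].
Definition prod_opp (x : P) : P := [ffun i => - x i].
Definition prod_add (x y : P) : P := [ffun i => x i + y i].
Definition prod_mul (x y : P) : P := [ffun i => x i * y i].
Definition prod_unit : pred P := fun x => [forall i, x i \is a GRing.unit].
Definition prod_inv (x : P) : P :=
  if prod_unit x then [ffun i => (x i)^-1] else x.

Fact prod_addA : associative prod_add.
Proof. by move=> x y z; apply/ffunP=> i; rewrite !ffunE addrA. Qed.
Fact prod_addC : commutative prod_add.
Proof. by move=> x y; apply/ffunP=> i; rewrite !ffunE addrC. Qed.
Fact prod_add0 : left_id prod_zero prod_add.
Proof. by move=> x; apply/ffunP=> i; rewrite !ffunE add0r. Qed.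
Fact prod_addN : left_inverse prod_zero prod_opp prod_add.
Proof. by move=> x; apply/ffunP=> i; rewrite !ffunE addNr. Qed.
HB.instance Definition _ :=
  GRing.isZmodule.Build P prod_addA prod_addC prod_add0 prod_addN.

Fact prod_mulA : associative prod_mul.
Proof. by move=> x y z; apply/ffunP=> i; rewrite !ffunE mulrA. Qed.
Fact prod_mulC : commutative prod_mul.
Proof. by move=> x y; apply/ffunP=> i; rewrite !ffunE mulrC. Qed.
Fact prod_mul1 : left_id prod_one prod_mul.
Proof. by move=> x; apply/ffunP=> i; rewrite !ffunE mul1r. Qed.
Fact prod_mulDl : left_distributive prod_mul prod_add.
Proof. by move=> x y z; apply/ffunP=> i; rewrite !ffunE mulrDl. Qed.
Fact prod_one_neq0 : prod_one != 0.
Proof. by apply/eqP=> /ffunP/(_ ord0)/eqP; rewrite !ffunE oner_eq0. Qed.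
HB.instance Definition _ :=
  GRing.Zmodule_isComNzRing.Build P
    prod_mulA prod_mulC prod_mul1 prod_mulDl prod_one_neq0.

Fact prod_mulV : {in prod_unit, left_inverse 1 prod_inv *%R}.
Proof.
move=> x xU; rewrite /prod_inv ifT //; apply/ffunP=> i.
by rewrite !ffunE mulVr //; move/forallP: xU; apply.
Qed.
Fact prod_unitP (x y : P) : y * x = 1 -> prod_unit x.
Proof.
move=> /ffunP yx; apply/forallP=> i; apply/unitrPr; exists (y i).
by move: (yx i); rewrite !ffunE mulrC.
Qed.
Fact prod_inv_out : {in [predC prod_unit], prod_inv =1 id}.
Proof. by move=> x /negbTE xU; rewrite /prod_inv ifF. Qed.
HB.instance Definition _ :=
  GRing.ComNzRing_hasMulInverse.Build P prod_mulV prod_unitP prod_inv_out.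
End ProdRing.

HB.instance Definition _ (S1 S2 : finComUnitRingType) :=
  Finite.on (S1 * S2)%type.

Record sgraph := SGraph {
  vertex :> finType;
  adj : rel vertex;
  adj_sym : symmetric adj;
  adj_irr : irreflexive adj
}.

Definition adjacency_mx (C : nzRingType) (G : sgraph) : 'M[C]_#|G| :=
  \matrix_(i, j) (adj (enum_val i) (enum_val j))%:R.

(* Adjacency eigenvalues with multiplicity: the (monic) characteristic
   polynomial is the product of the 'X - z%:P for z in this sequence. *)
Definition spectrum (C : numClosedFieldType) (G : sgraph) : seq C :=
  sval (closed_field_poly_normal (char_poly (adjacency_mx C G))).

Definition spectral_moment (C : numClosedFieldType) (G : sgraph) (k : nat) : C :=
  \sum_(z <- spectrum C G) z ^+ k.

Section QuadraticUnitaryCayley.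
Variable S : finComUnitRingType.

Definition unit_squares : {set S} := [set u ^+ 2 | u in (GRing.unit : {pred S})].

Definition signed_unit_squares : {set S} :=
  unit_squares :|: [set - x | x in unit_squares].

Definition quc_adj : rel S := fun x y => x - y \in signed_unit_squares.

Lemma quc_adj_sym : symmetric quc_adj.
Proof.
suff sym x y : quc_adj x y -> quc_adj y x.
  by move=> x y; apply/idP/idP; apply: sym.
rewrite /quc_adj -(opprB x y) !inE => /orP[xQ|].
  by rewrite imset_f ?orbT.
by case/imsetP=> z zQ ->; rewrite opprK zQ.
Qed.

Lemma quc_adj_irr : irreflexive quc_adj.
Proof.
have Q0 : (0 \in unit_squares) = false.
  apply/imsetP=> -[u uU /esym/eqP].
  by apply/negP; apply: contraTneq (unitrX 2 uU) => ->; rewrite unitr0.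
move=> x; rewrite /quc_adj subrr inE Q0; apply/imsetP=> -[z zQ /esym/eqP].
by rewrite oppr_eq0 => /eqP z0; rewrite z0 Q0 in zQ.
Qed.

Definition quc_graph : sgraph := SGraph quc_adj_sym quc_adj_irr.
End QuadraticUnitaryCayley.

(* Main.v *)
Require Import Defs.
From HB Require Import structures.
From mathcomp Require Import all_boot all_order all_fingroup all_algebra.
From mathcomp Require Import ring.

(* The k-th spectral moment is the trace of the k-th power of the adjacency
   matrix, and for a Cayley graph on S this is |S| times the value at 0 of the
   k-fold additive convolution of the indicator of the connection set.
   Convolution powers of product functions are products, so everything reduces
   to local rings.  Let S be local with residue field of odd order q and maximal
   ideal M of order m.  Squaring is two-to-one on units and bijective on 1 + M;
   hence the squares have index 2 in the units, are stable under translation by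
   M, and contain -1 iff q = 1 mod 4.  If q = 1 mod 4, the quadratic character
   chi of S (extended by 0 on M) satisfies chi * chi = mq 1_M - m, so the span
   of 1, 1_M, chi is stable under convolution by the indicator of the squares,
   which acts on it with eigenvalues m(q-1)/2 and m(-1 +- sqrt q)/2.  If
   q = 3 mod 4, the connection set of R_0 x R is the set of pairs of a unit of
   R_0 and a square of R, and units are handled by the span of 1 and 1_M. *)

Set Implicit Arguments.
Unset Strict Implicit.
Unset Printing Implicit Defensive.

Import Order.TTheory GRing.Theory Num.Theory.
Local Open Scope ring_scope.

(** * Spectral moments as convolution powers *)

(** Over the polynomials, ['X - invmx P *m D *m P] is itself the conjugate of ['X - D] by [P], and
    the determinants of [P] and its inverse cancel. *)
Lemma char_poly_conj (C : fieldType) n (P D : 'M[C]_n) :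
  P \in unitmx -> char_poly (invmx P *m D *m P) = char_poly D.
Proof.
move=> Pu; rewrite /char_poly /char_poly_mx !map_mxM /=.
have PK : map_mx polyC (invmx P) *m map_mx polyC P = 1%:M.
  by rewrite -map_mxM mulVmx // map_mx1.
rewrite -[X in X - _]mulmx1 -PK mulmxA -scalar_mxC -mulmxBl -mulmxBr.
by rewrite !det_mulmx mulrAC -det_mulmx PK det1 mul1r.
Qed.

Lemma mx_conj_expr (C : fieldType) n (P D : 'M[C]_n) k :
  P \in unitmx -> (invmx P *m D *m P) ^+ k = invmx P *m D ^+ k *m P.
Proof.
move=> Pu; elim: k => [|k IH]; first by rewrite !expr0 mulmx1 mulVmx.
rewrite !exprS IH /GRing.mul /= !mulmxA; congr (_ *m _ *m _).
by rewrite -[_ *m P *m _]mulmxA mulmxV ?mulmx1.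
Qed.

Lemma diag_mx_expr (C : fieldType) n (d : 'rV[C]_n) k :
  diag_mx d ^+ k = diag_mx (map_mx (fun z => z ^+ k) d).
Proof.
elim: k => [|k IH].
  rewrite expr0; apply/matrixP=> i j; rewrite !mxE; case: eqP => // _.
rewrite exprS IH /GRing.mul /= mulmx_diag; congr diag_mx.
by apply/rowP=> i; rewrite !mxE exprS.
Qed.

(** A real symmetric matrix is Hermitian, hence diagonalizable; the trace of its power sums the
    powers of the diagonal entries. *)
Lemma spectral_moment_mxtrace (C : numClosedFieldType) (G : sgraph) k :
  spectral_moment C G k = \tr (adjacency_mx C G ^+ k).
Proof.
set A := adjacency_mx C G.
have A_herm : A \is hermsymmx.
  apply/is_hermitianmxP; rewrite expr0 scale1r; apply/matrixP=> i j.
  by rewrite !mxE adj_sym conjC_nat.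
have /orthomx_spectralP defA := hermitian_normalmx A_herm.
have Pu := spectral_unit A.
set P := spectralmx A in defA Pu; set d := spectral_diag A in defA.
rewrite defA mx_conj_expr // mxtrace_mulC mulmxA mulmxV // mul1mx.
rewrite diag_mx_expr mxtrace_diag /spectral_moment /spectrum -/A.
case: closed_field_poly_normal => r /=.
rewrite (monicP (char_poly_monic A)) scale1r defA char_poly_conj //.
rewrite char_poly_trig ?diag_mx_is_trig //.
have -> : \prod_i ('X - (diag_mx d i i)%:P) =
    \prod_(z <- [seq d 0 i | i <- index_enum 'I_#|G|]) ('X - z%:P).
  by rewrite big_map; apply: eq_bigr => i _; rewrite mxE eqxx mulr1n.
(* By unique factorization into monic linear factors, the diagonal entries are a permutation of the
   spectrum. *)
move=> /prod_XsubC_eq dr; rewrite -(perm_big _ dr).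
by rewrite big_map; apply: eq_bigr => i _; rewrite mxE.
Qed.

Section Convolution.
Variables (C : comNzRingType) (S : finComUnitRingType).
Implicit Types f g h : S -> C.

Definition conv f g (x : S) : C := \sum_y f y * g (x - y).

(** Index [k] stands for [k.+1] factors [f], so no neutral element for convolution is involved. *)
Definition conv_pow f k : S -> C := iter k (conv f) f.

Lemma eq_conv f f' g g' : f =1 f' -> g =1 g' -> conv f g =1 conv f' g'.
Proof. by move=> ff gg x; apply: eq_bigr => y _; rewrite ff gg. Qed.

Lemma eq_conv_pow f f' k : f =1 f' -> conv_pow f k =1 conv_pow f' k.
Proof. by move=> ff; elim: k => //= k IH; apply: eq_conv. Qed.

Lemma convDr f g h x : conv f (fun y => g y + h y) x = conv f g x + conv f h x.
Proof. by rewrite -big_split; apply: eq_bigr => y _; rewrite mulrDr. Qed.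

Lemma convZr f g a x : conv f (fun y => a * g y) x = a * conv f g x.
Proof. by rewrite mulr_sumr; apply: eq_bigr => y _; rewrite mulrCA. Qed.

Lemma convC f g x : conv f g x = conv g f x.
Proof.
rewrite /conv (reindex_inj (inv_inj (subKr x))).
by apply: eq_bigr => y _; rewrite subKr mulrC.
Qed.

Lemma conv1 f a x : conv f (fun=> a) x = (\sum_y f y) * a.
Proof. by rewrite mulr_suml. Qed.

End Convolution.

Definition signed_square_ind (C : comNzRingType) (S : finComUnitRingType) (x : S) : C :=
  (x \in signed_unit_squares S)%:R.

(** The number of walks between two vertices depends only on their difference, so the matrix power
    has constant diagonal. *)
Lemma spectral_moment_conv_pow (C : numClosedFieldType) (S : finComUnitRingType) k :
  spectral_moment C (quc_graph S) k.+1 =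
  #|S|%:R * conv_pow (@signed_square_ind C S) k 0.
Proof.
rewrite spectral_moment_mxtrace; set A := adjacency_mx C _.
have AE i j : (A ^+ k.+1) i j =
    conv_pow (@signed_square_ind C S) k (enum_val i - enum_val j).
  elim: k i j => [|k IH] i j; first by rewrite expr1 mxE.
  rewrite exprS mxE /= /conv.
  (* The summation variable changes from the first step of the walk to the vertex it reaches. *)
  rewrite (reindex_inj (inv_inj (subKr (enum_val i)))) /=.
  rewrite [RHS](reindex (@enum_val S predT)) /=; last exact/onW_bij/enum_val_bij.
  apply: eq_bigr => l _; rewrite IH mxE; congr (_ * conv_pow _ _ _).
  have telescope (a b c : S) : b - c = a - c - (a - b).
    by rewrite opprB [RHS]addrC addrA subrK.
  exact: telescope.
rewrite /mxtrace; under eq_bigr do rewrite AE subrr.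
by rewrite sumr_const card_ord mulr_natl.
Qed.

Lemma conv_pow_pair (C : comNzRingType) (S1 S2 : finComUnitRingType)
    (f1 : S1 -> C) (f2 : S2 -> C) k (x : S1 * S2) :
  conv_pow (fun y : S1 * S2 => f1 y.1 * f2 y.2) k x =
  conv_pow f1 k x.1 * conv_pow f2 k x.2.
Proof.
elim: k x => //= k IH x; rewrite /conv big_distrlr pair_big /=.
by apply: eq_bigr => y _; rewrite IH mulrACA.
Qed.

Lemma bigA_distr_dffun (C : comNzRingType) (I : finType) (T : I -> finType)
    (F : forall i, T i -> C) :
  \sum_(x : {dffun forall i, T i}) \prod_i F i (x i) = \prod_i \sum_(y : T i) F i y.
Proof.
(* Dependent functions are recoded through tagged pairs, so that all factors share one codomain and
   ordinary distributivity applies. *)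
rewrite (reindex (@dffun_of_fprod I T)) /=; last exact/onW_bij/dffun_of_fprod_bij.
under [RHS]eq_bigr => i _ do under eq_bigr do rewrite -[F i _](ffunE (F i)).
under [RHS]eq_bigr => i _ do rewrite (big_tag (fun i => finfun (F i))).
rewrite bigA_distr_big_dep -big_fprod.
apply: eq_bigr => t _; apply: eq_bigr => i _.
by rewrite !ffunE.
Qed.

Lemma conv_pow_prod (C : comNzRingType) n (R : 'I_n.+1 -> finComUnitRingType)
    (f : forall i, R i -> C) k (x : prod_ring R) :
  conv_pow (fun y : prod_ring R => \prod_i f i (y i)) k x =
  \prod_i conv_pow (f i) k (x i).
Proof.
elim: k x => //= k IH x; rewrite /conv.
rewrite -(bigA_distr_dffun (fun i y => f i y * conv_pow (f i) k (x i - y))).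
by apply: eq_bigr => y _; rewrite IH -big_split; apply: eq_bigr => i _; rewrite !ffunE.
Qed.

(** * Finite local rings *)

(** Lagrange's theorem in the additive group. *)
Lemma card_zmod_closed_dvd (S : finZmodType) (A : {set S}) :
  zmod_closed A -> (#|A| %| #|S|)%N.
Proof.
move=> [A0 AB]; have gA : group_set A.
  apply/group_setP; split=> // x y xA yA.
  by rewrite FinRing.zmodMgE -[y]opprK -[- y]sub0r AB // AB.
by have := cardSg (subsetT (Group gA)); rewrite cardsT.
Qed.

(** The moved points fall into pairs [x], [f x]; the induction removes one pair at a time. *)
Lemma odd_card_involution (T : finType) (f : T -> T) (A : {set T}) :
  involutive f -> {in A, forall x, f x \in A} ->
  odd #|A| = odd #|[set x in A | f x == x]|.
Proof.
move=> fK; elim: {A}_.+1 {-2}A (ltnSn #|A|) => // b IH A leAb fA.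
have [fix_all | ] := boolP [forall x in A, f x == x].
  congr (odd #|pred_of_set _|); apply/setP=> x; rewrite inE.
  by case xA: (x \in A) => //=; move/forall_inP: fix_all => ->.
rewrite negb_forall_in => /exists_inP[x xA fx].
have fxA : f x \in A :\ x by rewrite !inE fx fA.
have cA : #|A| = #|A :\ x :\ f x|.+2.
  by rewrite (cardsD1 x) xA (cardsD1 (f x)) fxA.
rewrite cA /= negbK IH.
- congr (odd #|pred_of_set _|); apply/setP=> y; rewrite !inE.
  have [->|] //= := eqVneq y (f x).
    by rewrite fK eq_sym (negbTE fx) andbF.
  by have [->|] //= := eqVneq y x; rewrite (negbTE fx) andbF.
- by rewrite -ltnS (leq_trans _ leAb) // cA.
move=> y; rewrite !inE => /and3P[yfx yx yA].
rewrite (inj_eq (can_inj fK)) yx fA // andbT.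
by apply: contraNneq yfx => <-; rewrite fK.
Qed.

Section LocalRing.
Variables (S : finComUnitRingType) (M : {set S}).
Hypothesis hlocal : local_ring M.

Local Notation U := [set u : S | u \is a GRing.unit].
Local Notation Q := (unit_squares S).
Local Notation q := (residue_card M).
Local Notation m := #|M|.

Lemma local_ideal : idealr_closed M.
Proof. by case: hlocal => -[]. Qed.

Lemma local_ideal0 : 0 \in M.
Proof. by case: local_ideal. Qed.

Lemma local_idealMl a x : x \in M -> a * x \in M.
Proof.
by case: local_ideal => M0 _ Mcl xM; rewrite -[_ * _]addr0 Mcl.
Qed.

Lemma local_idealD x y : x \in M -> y \in M -> x + y \in M.
Proof. by case: local_ideal => _ _ Mcl xM; rewrite -[x]mul1r; apply: Mcl. Qed.

Lemma local_idealN x : (- x \in M) = (x \in M).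
Proof.
have sub y : y \in M -> - y \in M by rewrite -mulN1r; apply: local_idealMl.
by apply/idP/idP=> /sub; rewrite ?opprK.
Qed.

Lemma local_idealDl x y : x \in M -> (x + y \in M) = (y \in M).
Proof.
move=> xM; apply/idP/idP=> [xyM|]; last exact: local_idealD.
by rewrite -[y](addKr x) local_idealD // local_idealN.
Qed.

(** A nonunit generates a proper ideal, which lies in a maximal one, and the only maximal ideal is
    [M]. *)
Lemma local_unitE x : (x \is a GRing.unit) = (x \notin M).
Proof.
apply/idP/idP=> [xU | ].
  apply/negP=> /(local_idealMl x^-1); rewrite mulVr //.
  by case: local_ideal => _ /negP.
apply: contraR => xNU.
(* A boolean form of being an ideal, as [maxset_exists] requires. *)
pose idealb (N : {set S}) := [&& 0 \in N, 1 \notin N &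
  [forall a, forall u in N, forall v in N, a * u + v \in N]].
have idealP (N : {set S}) : reflect (idealr_closed N) (idealb N).
  apply: (iffP and3P) => [[N0 N1 /forallP cl]|[N0 N1 cl]]; split=> //.
    by move=> a u v uN vN; have /forall_inP/(_ u uN)/forall_inP := cl a; apply.
  by apply/forallP=> a; apply/forall_inP=> u uN; apply/forall_inP=> v; apply: cl.
pose I := [set x * a | a in [set: S]].
have I_ideal : idealb I.
  apply/idealP; split; first by rewrite -(mulr0 x) imset_f ?inE.
    by apply: contraNN xNU => /imsetP[a _ /esym xa]; apply/unitrPr; exists a.
  move=> a _ _ /imsetP[b _ ->] /imsetP[c _ ->].
  by rewrite mulrCA -mulrDr imset_f ?inE.
have [N /maxsetP[/idealP N_ideal N_max] subIN] := maxset_exists I_ideal.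
have <- : N = M.
  case: hlocal => _; apply; split=> // N' /idealP N'_ideal.
  exact: N_max.
by apply: (subsetP subIN); rewrite -[x]mulr1 imset_f ?inE.
Qed.

Lemma local_card : (q * m = #|S|)%N.
Proof. by rewrite divnK //; apply/card_zmod_closed_dvd/idealr_closedB/local_ideal. Qed.

Lemma local_card_max_gt0 : (0 < m)%N.
Proof. by apply/card_gt0P; exists 0; apply: local_ideal0. Qed.

Lemma local_card_units : (#|U| = (q - 1) * m)%N.
Proof.
rewrite mulnBl mul1n local_card -(cardC (mem M)) addKn.
by apply: eq_card => x; rewrite inE [RHS]inE local_unitE.
Qed.

Lemma residue_card_gt0 : (0 < q)%N.
Proof.
have : (0 < q * m)%N by rewrite local_card; apply/card_gt0P; exists 0.
by rewrite muln_gt0 => /andP[].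
Qed.

Lemma unit_squares_unit x : x \in Q -> x \is a GRing.unit.
Proof. by case/imsetP=> u uU ->; rewrite unitrX. Qed.

Lemma unit_squares_sqr x : x \is a GRing.unit -> x ^+ 2 \in Q.
Proof. by move=> xU; apply/imsetP; exists x. Qed.

Lemma unit_squares1 : 1 \in Q.
Proof. by rewrite -(expr1n _ 2) unit_squares_sqr ?unitr1. Qed.

Lemma unit_squaresM x y : x \in Q -> y \in Q -> x * y \in Q.
Proof.
case/imsetP=> u uU -> /imsetP[v vU ->].
by rewrite -exprMn unit_squares_sqr ?unitrM ?uU ?vU.
Qed.

Lemma unit_squaresV x : x \in Q -> x^-1 \in Q.
Proof. by case/imsetP=> u uU ->; rewrite -exprVn unit_squares_sqr ?unitrV. Qed.

Lemma unit_squaresMl x y : x \in Q -> (x * y \in Q) = (y \in Q).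
Proof.
move=> xQ; apply/idP/idP=> [xyQ|]; last exact: unit_squaresM.
by rewrite -[y](mulKr (unit_squares_unit xQ)) unit_squaresM ?unit_squaresV.
Qed.

(** * Squares of units when the residue field has odd order *)

Section OddResidue.
Hypothesis q_odd : odd q.

(* If 2 lay in M, then M together with 1 + M would be an additive subgroup of
   order 2m, so that 2m would divide qm. *)
Lemma local_unit2 : (2 : S) \is a GRing.unit.
Proof.
rewrite local_unitE; apply/negP=> M2.
pose M1 := [set 1 + x | x in M].
have M1E x : (x \in M1) = (x - 1 \in M).
  apply/imsetP/idP=> [[y yM ->]|xM]; first by rewrite addrC addKr.
  by exists (x - 1); rewrite // addrC subrK.
have dM : [disjoint M & M1].
  apply/pred0P=> x /=; rewrite M1E; apply/andP=> -[xM].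
  rewrite local_idealDl // local_idealN.
  by case: local_ideal => _ /negP.
have cM : #|M :|: M1| = (2 * m)%N.
  move: dM; rewrite -leq_card_setU => /eqP->.
  by rewrite card_imset ?mul2n ?addnn //; apply: addrI.
have cl : zmod_closed (M :|: M1).
  split=> [|x y]; first by rewrite inE local_ideal0.
  rewrite !inE !M1E => /orP[] xM /orP[] yM.
  - by rewrite local_idealDl ?local_idealN // yM.
  (* This case alone uses that 2 lies in [M]: [y + 1 = (y - 1) + 2]. *)
  - apply/orP; right; rewrite -addrA local_idealDl // -opprD local_idealN.
    rewrite -[y](subrK 1) -addrA local_idealDl //.
  - by apply/orP; right; rewrite addrAC local_idealDl ?local_idealN.
  - rewrite -(subrK 1 x) -(subrK 1 y) opprD addrACA subrr addr0.
    by rewrite local_idealDl ?local_idealN // yM.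
have := card_zmod_closed_dvd cl.
by rewrite cM -local_card dvdn_pmul2r ?local_card_max_gt0 // dvdn2 q_odd.
Qed.

Lemma local_neqN (u : S) : u \is a GRing.unit -> u != - u :> S.
Proof.
move=> uU; rewrite -subr_eq0 opprK -mulr2n -mulr_natl.
by apply: contraTneq local_unit2 => /eqP; rewrite mulIr_eq0 => [/eqP ->|]; [rewrite unitr0 | apply: mulIr].
Qed.

(* The sum of u - v and u + v is a unit, so one of the two factors of
   u^2 - v^2 is a unit and the other vanishes. *)
Lemma local_sqr_eq (u v : S) : u \is a GRing.unit ->
  (u ^+ 2 == v ^+ 2) = (u == v) || (u == - v).
Proof.
move=> uU; apply/idP/idP=> [|/orP[]/eqP->]; rewrite ?sqrrN //.
rewrite -subr_eq0 subr_sqr.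
have [uvM|] := boolP (u - v \in M).
  have vU : u + v \is a GRing.unit.
    rewrite local_unitE -(local_idealDl _ uvM) addrACA addNr addr0.
    by rewrite -local_unitE -mulr2n -mulr_natl unitrM local_unit2.
  by rewrite mulIr_eq0 ?subr_eq0 => [->|] //; apply: mulIr.
rewrite -local_unitE => uvU.
by rewrite mulrI_eq0 ?addr_eq0 => [->|]; rewrite ?orbT //; apply: mulrI.
Qed.

(** Each fibre of squaring on the units is a pair of distinct elements [u], [- u]. *)
Lemma local_card_squares : (#|U| = 2 * #|Q|)%N.
Proof.
have -> : Q = [set u ^+ 2 | u in U].
  by apply/setP=> x; apply/imsetP/imsetP=> -[u uU ->]; exists u => //; rewrite inE in uU *.
rewrite -[LHS]sum1_card (partition_big_imset (fun u => u ^+ 2)) /=.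
rewrite mulnC -sum_nat_const; apply: eq_bigr => y /imsetP[u]; rewrite inE => uU ->.
rewrite sum1dep_card.
transitivity #|[set u; - u]|; last by rewrite cards2 local_neqN.
apply: eq_card => v; rewrite !inE; symmetry.
apply/orP/andP=> [[]/eqP->|[vU]]; rewrite ?unitrN ?sqrrN //.
by rewrite local_sqr_eq // => /orP[]; [left | right].
Qed.

(** Squaring maps the finite set [1 + M] injectively into itself, hence onto itself. *)
Lemma local_add1_square x : x \in M -> 1 + x \in Q.
Proof.
move=> xM; pose M1 := [set 1 + y | y in M].
have M1U y : y \in M1 -> y \is a GRing.unit.
  case/imsetP=> z zM ->; rewrite addrC local_unitE local_idealDl //.
  by case: local_ideal.
have M1inj : {in M1 &, injective (fun y => y ^+ 2)}.
  move=> y z yM1 zM1 /eqP; rewrite local_sqr_eq ?M1U // => /orP[/eqP //|/eqP yz].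
  (* The alternative [y = - z] would put 2 in [M]. *)
  have := local_unit2; rewrite local_unitE; case/negP.
  case/imsetP: yM1 zM1 yz => y' y'M -> /imsetP[z' z'M ->].
  rewrite opprD => /eqP; rewrite -subr_eq0 opprD !opprK addrACA.
  rewrite -mulr2n => /eqP E.
  rewrite -[2%:R](addrK (y' + z')) E sub0r local_idealN.
  exact: local_idealD.
have M1sub : [set y ^+ 2 | y in M1] \subset M1.
  apply/subsetP=> _ /imsetP[_ /imsetP[y yM ->] ->].
  rewrite sqrrD expr1n mul1r -addrA; apply: imset_f.
  by rewrite local_idealD ?expr2 ?local_idealMl // -mulr_natl local_idealMl.
have /eqP/setP M1E : [set y ^+ 2 | y in M1] == M1.
  by rewrite eqEcard M1sub (card_in_imset M1inj) leqnn.
have : 1 + x \in M1 by apply: imset_f.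
by rewrite -M1E => /imsetP[y yM1 ->]; rewrite unit_squares_sqr ?M1U.
Qed.

Lemma local_squaresD x y : x \in M -> (x + y \in Q) = (y \in Q).
Proof.
suff sub z w : z \in M -> w \in Q -> z + w \in Q.
  move=> xM; apply/idP/idP=> [xyQ|]; last exact: sub.
  by rewrite -[y](addKr x) sub ?local_idealN.
move=> zM wQ; have wU := unit_squares_unit wQ.
have -> : z + w = w * (1 + w^-1 * z) by rewrite mulrDr mulr1 mulVKr // addrC.
by rewrite unit_squaresM ?local_add1_square ?local_idealMl.
Qed.

(** The squares have index 2 in the units, so multiplication by [x] carries them onto the nonsquare
    units. A nonsquare [y = x * z] then gives [x * y = x ^+ 2 * z]. *)
Lemma local_nonsquareM x y : x \is a GRing.unit -> x \notin Q ->
  y \is a GRing.unit -> (x * y \in Q) = (y \notin Q).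
Proof.
move=> xU xNQ yU; apply/idP/idP=> [xyQ|yNQ].
  apply: contraNN xNQ => yQ.
  by rewrite -(unit_squaresMl _ yQ) mulrC.
pose N := U :\: Q.
have cN : #|N| = #|Q|.
  rewrite cardsD (setIidPr _); last first.
    by apply/subsetP=> z /unit_squares_unit; rewrite inE.
  by rewrite local_card_squares mul2n -addnn addnK.
have xQ : [set x * z | z in Q] = N.
  apply/eqP; rewrite eqEcard card_imset ?cN ?leqnn; last exact: mulrI.
  rewrite andbT; apply/subsetP=> _ /imsetP[z zQ ->].
  rewrite !inE unitrM xU unit_squares_unit // !andbT.
  by rewrite mulrC unit_squaresMl.
have : y \in N by rewrite !inE yNQ.
by rewrite -xQ => /imsetP[z zQ ->]; rewrite mulrA -expr2 unit_squaresM ?unit_squares_sqr.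
Qed.

(** Since 2 is a unit, negation on [M] fixes only 0. *)
Lemma local_odd_max : odd m.
Proof.
rewrite (@odd_card_involution _ -%R); [|exact: opprK|by move=> x; rewrite local_idealN].
suff -> : [set x in M | - x == x] = [set 0] by rewrite cards1.
apply/setP=> x; rewrite !inE; apply/andP/eqP=> [[_ /eqP xx]|->].
  apply: (mulrI local_unit2); rewrite mulr0 mulr_natl mulr2n.
  by rewrite -{1}xx addNr.
by rewrite local_ideal0 oppr0.
Qed.

(* Inversion on the group of squares fixes only 1 and, when it is a square, -1. *)
Lemma local_squaresN1 : (-1 \in Q) = ~~ odd #|Q|.
Proof.
rewrite (@odd_card_involution _ GRing.inv); [|exact: invrK|exact: unit_squaresV].
have fixE x : x \in Q -> (x^-1 == x) = (x == 1) || (x == -1).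
  move=> xQ; have xU := unit_squares_unit xQ.
  by rewrite -local_sqr_eq // expr1n expr2 -(inj_eq (mulrI xU)) mulrV.
have [Q1|Q1] := boolP (-1 \in Q).
  rewrite [X in #|pred_of_set X|](_ : _ = [set 1; -1]).
    by rewrite cards2 local_neqN ?unitr1.
  apply/setP=> x; rewrite !inE; case xQ: (x \in Q); first by rewrite fixE.
  by apply/esym/negbTE; apply: contraFN xQ => /orP[]/eqP-> //; apply: unit_squares1.
rewrite [X in #|pred_of_set X|](_ : _ = [set 1]); first by rewrite cards1.
apply/setP=> x; rewrite !inE; case xQ: (x \in Q).
  by rewrite fixE //; case: (x =P -1) xQ => [->|]; rewrite ?orbF // (negbTE Q1).
by apply/esym/negbTE; apply: contraFN xQ => /eqP->; apply: unit_squares1.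
Qed.

End OddResidue.

(** * The signed squares for residue order 1 or 3 modulo 4 *)

Lemma odd_mod4 r : (q = r %[mod 4])%N -> odd r -> odd q.
Proof. by move=> qr; rewrite -(odd_mod q (erefl : odd 4 = false)) qr odd_mod. Qed.

(** For [q = 4t + 1] there are [2tm] squares, an even number, so -1 is a square. *)
Lemma local_signed_squares_mod1 : (q = 1 %[mod 4])%N -> signed_unit_squares S = Q.
Proof.
move=> q1; have q_odd := odd_mod4 q1 isT.
have Q1 : -1 \in Q.
  rewrite local_squaresN1 //.
  have := local_card_squares q_odd; rewrite local_card_units.
  rewrite (divn_eq q 4) q1 addnK => /(congr1 (fun n => n %/ 2)%N).
  rewrite mulKn // => <-.
  by rewrite (_ : 4 = 2 * 2)%N // mulnC !mulnA mulnK // !oddM andbF.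
apply/setP=> x; rewrite inE; case xQ: (x \in Q) => //=.
by apply/imsetP=> -[y yQ xy]; rewrite xy -mulN1r unit_squaresMl ?yQ in xQ.
Qed.

(** For [q = 4t + 3] there are [(2t + 1)m] squares, an odd number since [m] is odd. So -1 is not a
    square, and negation exchanges squares and nonsquare units. *)
Lemma local_squaresN_mod3 : (q = 3 %[mod 4])%N ->
  forall x, (x \in Q) || (- x \in Q) = (x \is a GRing.unit).
Proof.
move=> q3 x; have q_odd := odd_mod4 q3 isT.
have Q1 : -1 \notin Q.
  rewrite local_squaresN1 // negbK.
  have := local_card_squares q_odd; rewrite local_card_units.
  rewrite (divn_eq q 4) q3 -addnBA // => /(congr1 (fun n => n %/ 2)%N).
  rewrite mulKn // => <-.
  rewrite (_ : 3 %% 4 - 1 = 1 * 2)%N // (_ : 4 = 2 * 2)%N // mulnA -mulnDl mulnAC mulnK //.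
  by rewrite oddM oddD oddM andbF local_odd_max.
apply/idP/idP=> [/orP[/unit_squares_unit //|/unit_squares_unit]|xU].
  by rewrite unitrN.
by rewrite -mulN1r local_nonsquareM ?unitrN1 ?orbN.
Qed.

End LocalRing.

(** * Convolution powers on local rings *)

Section LocalSpectrum.
Variables (C : numClosedFieldType) (S : finComUnitRingType) (M : {set S}).
Hypothesis hlocal : local_ring M.

Local Notation Q := (unit_squares S).
Local Notation q := (residue_card M).
Local Notation m := #|M|.
Local Notation qC := (q%:R : C).
Local Notation mC := (m%:R : C).
Local Notation Mind x := ((x \in M)%:R : C).
Local Notation MindF := (fun x : S => (x \in M)%:R : C).
Local Notation Uind x := ((x \is a GRing.unit)%:R : C).
Local Notation UindF := (fun x : S => (x \is a GRing.unit)%:R : C).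
Local Notation Qind x := ((x \in Q)%:R : C).
Local Notation QindF := (fun x : S => (x \in Q)%:R : C).

Let mC_neq0 : mC != 0.
Proof. by rewrite pnatr_eq0 -lt0n (local_card_max_gt0 hlocal). Qed.

Let qC_neq0 : qC != 0.
Proof. by rewrite pnatr_eq0 -lt0n (residue_card_gt0 hlocal). Qed.

Let card_SE : #|S|%:R = mC * qC.
Proof. by rewrite -natrM mulnC local_card. Qed.

Lemma sum_indicator (A : {pred S}) : \sum_x (x \in A)%:R = #|A|%:R :> C.
Proof. by rewrite -natr_sum -big_mkcond sum1_card. Qed.

Lemma UindE (x : S) : Uind x = 1 - Mind x.
Proof. by rewrite /= (local_unitE hlocal); case: (x \in M); rewrite ?subrr ?subr0. Qed.

Lemma sum_Uind : \sum_(x : S) Uind x = mC * (qC - 1).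
Proof.
under eq_bigr do rewrite UindE; rewrite sumrB sumr_const sum_indicator.
by rewrite card_SE; ring.
Qed.

Lemma conv_Mind f : (forall x y, x \in M -> f (x + y) = f y) ->
  conv MindF f =1 fun x => mC * f x.
Proof.
move=> fM x; rewrite -sum_indicator mulr_suml; apply: eq_bigr => y _.
have [yM|] := boolP (y \in M); last by rewrite !mul0r.
by rewrite -(fM (- y) x) ?local_idealN // addrC.
Qed.

Lemma conv_MindM : conv MindF MindF =1 fun x => mC * Mind x.
Proof. by apply: conv_Mind => x y xM; rewrite local_idealDl. Qed.

(** The functions 1 and [1_M - 1/q] are eigenfunctions with eigenvalues [m(q - 1)] and [-m]; the
    indicator of the units is [(q - 1)/q] times the first minus the second. *)
Lemma conv_pow_units k x :
  conv_pow UindF k x = (mC * (qC - 1)) ^+ k.+1 / (mC * qC)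
    + (- mC) ^+ k.+1 / mC * (Mind x - qC^-1).
Proof.
elim: k x => [|k IH] x; first by rewrite /= UindE !expr1; field; rewrite ?mC_neq0 ?qC_neq0.
(* The coefficients of 1 and of the indicator of [M] in the induction hypothesis. *)
pose a := (mC * (qC - 1)) ^+ k.+1 / (mC * qC) - (- mC) ^+ k.+1 / mC * qC^-1.
pose b := (- mC) ^+ k.+1 / mC.
have E : conv_pow UindF k.+1 x = conv UindF (fun y => a + b * Mind y) x.
  by apply: eq_conv => // y; rewrite [LHS]IH /a /b; ring.
rewrite E convDr convZr conv1 [conv UindF _ x]convC.
have -> : conv MindF UindF x = conv MindF (fun y => 1 + (-1) * Mind y) x.
  by apply: eq_conv => // y; rewrite UindE mulN1r.
rewrite convDr convZr !conv1 conv_MindM sum_Uind sum_indicator.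
rewrite /a /b ![_ ^+ k.+2]exprS.
by field; rewrite ?mC_neq0 ?qC_neq0.
Qed.

(** * Residue order 1 modulo 4: the quadratic character *)

Section Paley.
Hypothesis q_mod4 : (q = 1 %[mod 4])%N.

Let q_odd : odd q := odd_mod4 q_mod4 isT.

(** The quadratic character: 1 on squares of units, -1 on nonsquare units, 0 on [M]. *)
Definition quad_char x : C := 2 * Qind x - Uind x.
Local Notation chi := quad_char.

Lemma QindE x : Qind x = (1 - Mind x + chi x) / 2.
Proof. by rewrite /chi UindE; field. Qed.

Lemma quad_char_nonunit x : x \in M -> chi x = 0.
Proof.
move=> xM; rewrite /chi; have xNU : (x \is a GRing.unit) = false.
  by rewrite (local_unitE hlocal) // xM.
rewrite xNU; case xQ: (x \in Q); last by rewrite mulr0 subrr.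
by rewrite (unit_squares_unit xQ) in xNU.
Qed.

Lemma quad_charMl u x : u \is a GRing.unit -> chi (u * x) = chi u * chi x.
Proof.
move=> uU; have [xU|xNU] := boolP (x \is a GRing.unit); last first.
  rewrite !(quad_char_nonunit (x := x)) ?mulr0 ?quad_char_nonunit //.
    by rewrite local_idealMl // -[_ \in _]negbK -(local_unitE hlocal).
  by rewrite -[_ \in _]negbK -(local_unitE hlocal).
rewrite /chi unitrM uU xU /=.
have [uQ|uNQ] := boolP (u \in Q).
  by rewrite unit_squaresMl // !mulr1n; ring.
rewrite (local_nonsquareM hlocal) //.
by case: (x \in Q); rewrite ?mulr1n ?mulr0n; ring.
Qed.

Lemma quad_char_sqr u : u \is a GRing.unit -> chi u * chi u = 1.
Proof.
by move=> uU; rewrite -quad_charMl // -expr2 /chi unit_squares_sqr // unitrX // !mulr1n; ring.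
Qed.

Lemma quad_charN x : chi (- x) = chi x.
Proof.
rewrite -mulN1r quad_charMl ?unitrN1 // /chi.
suff -> : -1 \in Q by rewrite unitrN1 !mulr1n; ring.
rewrite -(local_signed_squares_mod1 hlocal q_mod4) inE orbC imset_f //.
exact: unit_squares1.
Qed.

Lemma quad_charD x y : x \in M -> chi (x + y) = chi y.
Proof. by move=> xM; rewrite /chi (local_squaresD hlocal) // !(local_unitE hlocal) local_idealDl. Qed.

Lemma sum_Qind : \sum_(x : S) Qind x = mC * (qC - 1) / 2.
Proof.
have := local_card_squares hlocal q_odd; rewrite (local_card_units hlocal).
move=> /(congr1 (fun n => n%:R : C)); rewrite !natrM natrB ?(residue_card_gt0 hlocal) //.
by rewrite sum_indicator mulrC => ->; field.
Qed.

Lemma sum_quad_char : \sum_x chi x = 0.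
Proof. by rewrite sumrB -mulr_sumr sum_Qind sum_Uind; field. Qed.

(* For a unit x the substitution y = x / z turns the sum of chi y chi (x - y)
   into the sum of chi (z - 1) over the units z. *)
Lemma conv_quad_char x : conv chi chi x = mC * qC * Mind x - mC.
Proof.
have [xM|xNM] := boolP (x \in M).
  (* For [x] in [M], [chi (x - y) = chi y], so the sum counts the units. *)
  rewrite /conv; under eq_bigr => y _.
    rewrite quad_charD // quad_charN.
    have -> : chi y * chi y = Uind y.
      have [yU|yNU] := boolP (y \is a GRing.unit); first exact: quad_char_sqr.
      by rewrite quad_char_nonunit ?mul0r // -[_ \in _]negbK -(local_unitE hlocal).
    over.
  by rewrite sum_Uind; rewrite mulr1n; ring.
have xU : x \is a GRing.unit by rewrite (local_unitE hlocal).
rewrite mulr0 sub0r /conv (bigID (fun y => y \is a GRing.unit)) /=.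
rewrite [X in _ + X]big1 => [|y yNU]; last first.
  by rewrite quad_char_nonunit ?mul0r // -[_ \in _]negbK -(local_unitE hlocal).
rewrite addr0 (reindex_inj (inj_comp (mulrI xU) invr_inj)) /=.
under eq_big => [z|z].
  by rewrite unitrM unitrV xU /=; over.
  rewrite unitrM unitrV xU /= => zU.
  have -> : x - x / z = x / z * (z - 1) by rewrite mulrBr mulrVK // mulr1.
  rewrite (quad_charMl (u := x / z)) ?unitrM ?unitrV ?xU //.
  rewrite mulrA quad_char_sqr ?unitrM ?unitrV ?xU // mul1r.
  over.
(* Over all [z] the values [chi (z - 1)] sum to 0, so the units contribute minus the sum over [M],
   where each term is [chi (-1) = 1]. *)
have := sum_quad_char; rewrite (reindex_inj (addIr (-1))) /=.
rewrite (bigID (fun z => z \is a GRing.unit)) /= => /eqP; rewrite addr_eq0 => /eqP ->.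
congr (- _); rewrite -sum_indicator big_mkcond; apply: eq_bigr => z _.
rewrite (local_unitE hlocal) negbK; case: ifP => // zM.
rewrite quad_charD // quad_charN /chi unit_squares1 unitr1 !mulr1n; ring.
Qed.

Variable r : C.
Hypothesis r_sqr : r ^+ 2 = qC.

(* The coefficients express the indicator of the squares in the eigenfunctions
   1 and r (1_M - 1/q) +- chi. *)
Lemma conv_pow_squares k x :
  conv_pow QindF k x = (mC * (qC - 1) / 2) ^+ k.+1 / (mC * qC)
    + ((mC * (-1 + r) / 2) ^+ k.+1 + (mC * (-1 - r) / 2) ^+ k.+1) / (2 * mC)
      * (Mind x - qC^-1)
    + ((mC * (-1 + r) / 2) ^+ k.+1 - (mC * (-1 - r) / 2) ^+ k.+1) / (2 * mC * r)
      * chi x.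
Proof.
have r_neq0 : r != 0 by move: qC_neq0; rewrite -r_sqr expf_eq0.
elim: k x => [|k IH] x.
  by rewrite [LHS]QindE !expr1 -r_sqr; field; rewrite ?r_neq0 ?mC_neq0 ?qC_neq0.
set B := (mC * (-1 + r) / 2) ^+ k.+1 in IH *.
set D := (mC * (-1 - r) / 2) ^+ k.+1 in IH *.
set A := (mC * (qC - 1) / 2) ^+ k.+1 in IH *.
(* [A], [B], [D] are powers of the three eigenvalues; [a], [b], [c] are the coefficients of 1, the
   indicator of [M], and [chi]. *)
pose a := A / (mC * qC) - (B + D) / (2 * mC) / qC.
pose b := (B + D) / (2 * mC).
pose c := (B - D) / (2 * mC * r).
have E : conv_pow QindF k.+1 x =
    conv QindF (fun y => a + (b * Mind y + c * chi y)) x.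
  by apply: eq_conv => // y; rewrite [LHS]IH /a /b /c; ring.
rewrite E convDr conv1 convDr !convZr sum_Qind.
rewrite convC conv_Mind => [|y z yM]; last by rewrite (local_squaresD hlocal).
(* Expanding the indicator of the squares by [QindE] leaves only convolutions of [chi] with 1, the
   indicator of [M], and itself. *)
have -> : conv QindF chi x =
    conv chi (fun y => 2^-1 + (- 2^-1 * Mind y + 2^-1 * chi y)) x.
  by rewrite convC; apply: eq_conv => // y; rewrite QindE; ring.
rewrite convDr conv1 convDr !convZr sum_quad_char conv_quad_char.
rewrite convC conv_Mind => [|y z yM]; last exact: quad_charD.
rewrite QindE ![_ ^+ k.+2]exprS -/A -/B -/D /a /b /c -r_sqr.
by field; rewrite ?r_neq0 ?mC_neq0 ?qC_neq0.
Qed.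

End Paley.
End LocalSpectrum.

(** * Products *)

(** At 0 the indicator of [M] is 1 and the character vanishes. The factor [|S| = mq] makes
    [m(q - 1)/2] count once and each [m(-1 +- sqrt q)/2] count [(q - 1)/2] times. *)
Lemma local_moment_squares (C : numClosedFieldType) (S : finComUnitRingType)
    (M : {set S}) (hlocal : local_ring M) (q1 : (residue_card M = 1 %[mod 4])%N) k :
  #|S|%:R * conv_pow (fun x : S => (x \in unit_squares S)%:R : C) k 0 =
  (#|M|%:R ^+ k.+1 * ((residue_card M)%:R - 1)) / 2 ^+ k.+2 *
  (2 * ((residue_card M)%:R - 1) ^+ k
   + (-1 + sqrtC (residue_card M)%:R) ^+ k.+1
   + (-1 - sqrtC (residue_card M)%:R) ^+ k.+1).
Proof.
have m_neq0 : (#|M|%:R : C) != 0 by rewrite pnatr_eq0 -lt0n (local_card_max_gt0 hlocal).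
have q_neq0 : ((residue_card M)%:R : C) != 0.
  by rewrite pnatr_eq0 -lt0n (residue_card_gt0 hlocal).
have M0 := local_ideal0 hlocal.
rewrite (conv_pow_squares hlocal q1 (sqrtCK _)) (quad_char_nonunit C hlocal M0).
rewrite mulr0 addr0 M0 mulr1n -(local_card hlocal) natrM !exprMn !exprVn.
rewrite !(exprS _ k.+1) !(exprS _ k).
have e2 : (2 ^+ k : C) != 0 by rewrite expf_neq0 // pnatr_eq0.
by field; rewrite ?m_neq0 ?q_neq0 ?e2.
Qed.

(** Here [m(q - 1)] counts once and [-m] counts [q - 1] times. *)
Lemma local_moment_units (C : numClosedFieldType) (S : finComUnitRingType)
    (M : {set S}) (hlocal : local_ring M) k :
  #|S|%:R * conv_pow (fun x : S => (x \is a GRing.unit)%:R : C) k 0 =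
  #|M|%:R ^+ k.+1 * ((residue_card M)%:R - 1) *
  (((residue_card M)%:R - 1) ^+ k + (-1) ^+ k.+1).
Proof.
have m_neq0 : (#|M|%:R : C) != 0 by rewrite pnatr_eq0 -lt0n (local_card_max_gt0 hlocal).
have q_neq0 : ((residue_card M)%:R : C) != 0.
  by rewrite pnatr_eq0 -lt0n (residue_card_gt0 hlocal).
rewrite (conv_pow_units C hlocal) (local_ideal0 hlocal).
rewrite mulr1n -(local_card hlocal) natrM -[- #|M|%:R]mulN1r !exprMn.
rewrite !(exprS _ k).
by field; rewrite ?m_neq0 ?q_neq0.
Qed.

Lemma signed_unit_squaresE (S : finComUnitRingType) (x : S) :
  (x \in signed_unit_squares S) = (x \in unit_squares S) || (- x \in unit_squares S).
Proof.
rewrite inE; congr (_ || _); apply/imsetP/idP=> [[y yQ ->]|xQ]; first by rewrite opprK.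
by exists (- x); rewrite ?opprK.
Qed.

Lemma prod_unit_squaresE n (R : 'I_n.+1 -> finComUnitRingType) (x : prod_ring R) :
  (x \in unit_squares (prod_ring R)) = [forall i, x i \in unit_squares (R i)].
Proof.
apply/imsetP/forallP=> [[u /forallP uU ->] i|xQ].
  by rewrite expr2 ffunE -expr2; apply/unit_squares_sqr/uU.
(* A square root is chosen in each factor; the default 0 never occurs, since every [x i] is the
   square of a unit. *)
pose u : prod_ring R :=
  [ffun i => odflt 0 [pick v : R i | (v \is a GRing.unit) && (v ^+ 2 == x i)]].
have uP i : (u i \is a GRing.unit) && (u i ^+ 2 == x i).
  rewrite ffunE; case: pickP => [v //|noroot].
  by have /imsetP[v vU xv] := xQ i; have := noroot v; rewrite xv eqxx andbT [_ \is a _]vU.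
exists u; first by apply/forallP=> i; case/andP: (uP i).
by apply/ffunP=> i; rewrite expr2 ffunE -expr2; case/andP: (uP i) => _ /eqP.
Qed.

Lemma pair_unit_squaresE (S1 S2 : finComUnitRingType) (x : S1 * S2) :
  (x \in unit_squares (S1 * S2)%type) =
  (x.1 \in unit_squares S1) && (x.2 \in unit_squares S2).
Proof.
apply/imsetP/andP=> [[u /andP[u1 u2] ->]|[/imsetP[u uU xu] /imsetP[v vU xv]]].
  by rewrite expr2 /= -!expr2 !unit_squares_sqr.
exists (u, v); first by apply/andP.
by rewrite [x]surjective_pairing xu xv !expr2.
Qed.

Section Products.
Variables (C : numClosedFieldType) (n : nat).
Variables (R : 'I_n.+1 -> finComUnitRingType) (M : forall i, {set R i}).
Hypothesis hlocal : forall i, local_ring (M i).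
Hypothesis hmod : forall i, (residue_card (M i) = 1 %[mod 4])%N.

(** Negation preserves the squares in every factor, each residue order being 1 modulo 4. *)
Lemma prod_unit_squaresN (x : prod_ring R) :
  (- x \in unit_squares (prod_ring R)) = (x \in unit_squares (prod_ring R)).
Proof.
rewrite !prod_unit_squaresE; apply: eq_forallb => i; rewrite ffunE.
have := local_signed_squares_mod1 (hlocal i) (@hmod i) => /setP QE.
have N y : y \in unit_squares (R i) -> - y \in unit_squares (R i).
  by move=> yQ; rewrite -QE signed_unit_squaresE opprK yQ orbT.
by apply/idP/idP=> /N //; rewrite opprK.
Qed.

Lemma prod_unit_squares_ind (x : prod_ring R) :
  (x \in unit_squares (prod_ring R))%:R =
  \prod_i (x i \in unit_squares (R i))%:R :> C.
Proof.
rewrite prod_unit_squaresE -natr_prod; congr _%:R.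
have [/forallP xQ|] := boolP [forall i, x i \in unit_squares (R i)].
  by rewrite big1 // => i _; rewrite xQ.
by rewrite negb_forall => /existsP[i xi]; rewrite (bigD1 i) //= (negbTE xi) mul0n.
Qed.

Lemma prod_moment_squares k :
  #|{: prod_ring R}|%:R *
    conv_pow (fun x : prod_ring R => (x \in unit_squares (prod_ring R))%:R : C) k 0 =
  \prod_(i < n.+1)
    ((#|M i|%:R ^+ k.+1 * ((residue_card (M i))%:R - 1)) / 2 ^+ k.+2) *
  \prod_(i < n.+1)
    (2 * ((residue_card (M i))%:R - 1) ^+ k
     + (-1 + sqrtC (residue_card (M i))%:R) ^+ k.+1
     + (-1 - sqrtC (residue_card (M i))%:R) ^+ k.+1).
Proof.
rewrite (eq_conv_pow k prod_unit_squares_ind).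
rewrite (conv_pow_prod (fun i (y : R i) => (y \in unit_squares (R i))%:R : C)).
have -> : #|{: prod_ring R}| = (\prod_i #|R i|)%N.
  by rewrite -card_fprod; apply: bij_eq_card (fprod_of_dffun_bij _).
rewrite natr_prod -!big_split; apply: eq_bigr => i _ /=.
by rewrite ffunE (local_moment_squares C (hlocal i)).
Qed.

End Products.

Theorem theorem4p2 (C : numClosedFieldType) (n : nat)
    (R : 'I_n.+1 -> finComUnitRingType) (M : forall i : 'I_n.+1, {set R i})
    (R0 : finComUnitRingType) (M0 : {set R0})
    (hlocal : forall i, local_ring (M i))
    (hsorted : forall i j : 'I_n.+1,
       (i <= j)%N -> (residue_card (M i) <= residue_card (M j))%N)
    (hmod : forall i, (residue_card (M i) = 1 %[mod 4])%N)
    (hlocal0 : local_ring M0)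
    (hmod0 : (residue_card M0 = 3 %[mod 4])%N)
    (k : nat) (hk : (1 <= k)%N) :
  spectral_moment C (quc_graph (prod_ring R)) k =
    \prod_(i < n.+1)
      ((#|M i|%:R ^+ k * ((residue_card (M i))%:R - 1)) / 2 ^+ k.+1) *
    \prod_(i < n.+1)
      (2 * ((residue_card (M i))%:R - 1) ^+ k.-1
       + (-1 + sqrtC (residue_card (M i))%:R) ^+ k
       + (-1 - sqrtC (residue_card (M i))%:R) ^+ k)
  /\
  spectral_moment C (quc_graph (R0 * prod_ring R)%type) k =
    #|M0|%:R ^+ k * ((residue_card M0)%:R - 1) *
    (((residue_card M0)%:R - 1) ^+ k.-1 + (-1) ^+ k) *
    \prod_(i < n.+1)
      ((#|M i|%:R ^+ k * ((residue_card (M i))%:R - 1)) / 2 ^+ k.+1) *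
    \prod_(i < n.+1)
      (2 * ((residue_card (M i))%:R - 1) ^+ k.-1
       + (-1 + sqrtC (residue_card (M i))%:R) ^+ k
       + (-1 - sqrtC (residue_card (M i))%:R) ^+ k).
Proof.
case: k hk => // k _; rewrite !spectral_moment_conv_pow [k.+1.-1]/=; split.
  rewrite -(prod_moment_squares C hlocal hmod); congr (_ * _).
  apply: eq_conv_pow => x; rewrite /signed_square_ind signed_unit_squaresE.
  by rewrite (prod_unit_squaresN hlocal hmod) orbb.
rewrite -mulrA -(prod_moment_squares C hlocal hmod) -(local_moment_units C hlocal0).
rewrite mulrACA -natrM -(conv_pow_pair _ _ k (0 : R0, 0 : prod_ring R)).
rewrite -card_prod; congr (_ * _).
(* As the squares of the product ring are stable under negation, the sign affects only the first
   coordinate, where squares and their negatives make up all units of [R0]. *)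
apply: eq_conv_pow => -[x y]; rewrite /signed_square_ind signed_unit_squaresE.
rewrite !pair_unit_squaresE /= (prod_unit_squaresN hlocal hmod) -andb_orl.
by rewrite (local_squaresN_mod3 hlocal0 hmod0) -natrM mulnb.
Qed.
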